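(* Consider a curve $\gamma\colon I\to\mathbb{S}^n\subset\mathbb{R}^{n+1}$ of the form $$\gamma(s)=\cos(as)e_1+\sin(as)e_2+\cos(bs)e_3+\sin(bs)e_4$$ with $|e_1|^2=|e_2|^2$, $|e_3|^2=|e_4|^2$ and $|e_1|^2+|e_3|^2=1$. Then $\gamma$ is a proper triharmonic curve parametrized by arclength if the following algebraic relations hold: \begin{align*} a^4+b^4-4(a^2+b^2)+3a^2b^2+3&=0,\\ |e_1|^2a^2+|e_3|^2b^2&=1. \end{align*}
   Context: Here $I\subset\mathbb{R}$ is an interval, $a,b\in\mathbb{R}$, and $e_1,\dots,e_4$ are constant vectors in $\mathbb{R}^{n+1}$. $\mathbb{S}^n\subset\mathbb{R}^{n+1}$ is the unit sphere with the round metric. Let $T=\gamma'$ and let $\nabla_T$ be covariant differentiation along $\gamma$ for the Levi-Civita connection. A curve $\gamma\colon I\to M$ into a Riemannian manifold $(M,g)$ is called triharmonic if it is a critical point of $E_3(\gamma)=\frac12\int_I|\nabla_T^{2}T|^2\,ds$, equivalently if $$0=\nabla_T^5T+R^M(\nabla_T^3T,T)T-R^M(\nabla_T^2T,\nabla_TT)T,$$ where $R^M$ is the curvature tensor of $M$; for $M=\mathbb{S}^n$ one has $R(X,Y)Z=\langle Y,Z\rangle X-\langle X,Z\rangle Y$. A geodesic is a curve with $\nabla_TT=0$; a triharmonic curve is called proper if it is not a geodesic. Parametrized by arclength means $|\gamma'|=1$.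
   Formalization: Added hypotheses: a² ≠ 1 and b² ≠ 1 (otherwise γ is a great circle, not proper), ⟨e1,e2⟩ = 0 if b² = 9a², and ⟨e3,e4⟩ = 0 if a² = 9b² (otherwise γ can lie on the sphere without unit speed); only cases where the claim fails are excluded. *)

(* Defs.v *)
From mathcomp Require Import all_boot all_order all_algebra.
From mathcomp Require Import all_classical all_reals all_analysis.

Set Implicit Arguments.
Unset Strict Implicit.
Unset Printing Implicit Defensive.

Import Order.TTheory GRing.Theory Num.Theory.
Import numFieldNormedType.Exports.

Local Open Scope classical_set_scope.
Local Open Scope ring_scope.

(* The norm that MathComp-Analysis puts on 'rV[R]_n.+1 is the sup norm; it is
   used below only through the topology (derivatives).  All lengths and angles
   are the Euclidean ones. *)
Definition dotv (R : realType) (n : nat) (u v : 'rV[R]_n.+1) : R :=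
  \sum_(i < n.+1) u ord0 i * v ord0 i.

Definition enorm (R : realType) (n : nat) (u : 'rV[R]_n.+1) : R :=
  Num.sqrt (dotv u u).

(* A curve I -> S^n is represented by a function g defined on all of R together
   with a set I; only its behaviour on I matters.  When I contains an endpoint
   and g is differentiable there, the two-sided derivative below is the
   one-sided derivative of the restriction of g to I. *)

Definition nondegenerate_interval (R : realType) (I : set R) : Prop :=
  is_interval I /\ exists s t, [/\ I s, I t & s < t].

Definition maps_to_sphere (R : realType) (n : nat) (I : set R)
    (g : R -> 'rV[R]_n.+1) : Prop :=
  forall s, I s -> enorm (g s) = 1.

Definition smooth_on (R : realType) (n : nat) (I : set R)
    (g : R -> 'rV[R]_n.+1) : Prop :=
  forall (k : nat) s, I s -> derivable (derive1n k g) s 1.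

(* Levi-Civita covariant derivative along g of a vector field V along g, for
   the round metric of S^n: the orthogonal projection of the Euclidean
   derivative V' onto the tangent space of S^n at g s, i.e. onto the
   orthogonal complement of the unit vector g s. *)
Definition covd (R : realType) (n : nat) (g V : R -> 'rV[R]_n.+1)
    : R -> 'rV[R]_n.+1 :=
  fun s => derive1 V s - dotv (derive1 V s) (g s) *: g s.

(* nablaT k g is the k-fold covariant derivative of the tangent field g'. *)
Definition nablaT (R : realType) (n : nat) (k : nat) (g : R -> 'rV[R]_n.+1)
    : R -> 'rV[R]_n.+1 :=
  iter k (covd g) (derive1 g).

Definition curv (R : realType) (n : nat) (X Y Z : 'rV[R]_n.+1)
    : 'rV[R]_n.+1 :=
  dotv Y Z *: X - dotv X Z *: Y.

Definition geodesic (R : realType) (n : nat) (I : set R)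
    (g : R -> 'rV[R]_n.+1) : Prop :=
  forall s, I s -> nablaT 1 g s = 0.

Definition triharmonic (R : realType) (n : nat) (I : set R)
    (g : R -> 'rV[R]_n.+1) : Prop :=
  [/\ maps_to_sphere I g, smooth_on I g &
      forall s, I s ->
        nablaT 5 g s
        + curv (nablaT 3 g s) (nablaT 0 g s) (nablaT 0 g s)
        - curv (nablaT 2 g s) (nablaT 1 g s) (nablaT 0 g s) = 0].

Definition proper_triharmonic (R : realType) (n : nat) (I : set R)
    (g : R -> 'rV[R]_n.+1) : Prop :=
  triharmonic I g /\ ~ geodesic I g.

Definition arclength_param (R : realType) (n : nat) (I : set R)
    (g : R -> 'rV[R]_n.+1) : Prop :=
  forall s, I s -> enorm (derive1 g s) = 1.

(* Main.v *)
Require Import Defs.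
From mathcomp Require Import all_boot all_order all_algebra.
From mathcomp Require Import all_classical all_reals all_analysis.
From mathcomp Require Import ring lra.

Set Implicit Arguments.
Unset Strict Implicit.

Import Order.TTheory GRing.Theory Num.Theory.
Import numFieldNormedType.Exports.

Local Open Scope classical_set_scope.
Local Open Scope ring_scope.

(** The curve is g = P + Q with P and Q parametrizing the e1, e2 part and the
    e3, e4 part.  Expanding |g| ^ 2 = 1 gives a sum of sines and cosines of
    frequencies 2a, 2b, a - b, a + b that vanishes on an interval.  If these
    frequencies are nonzero and distinct, all its coefficients vanish; at
    b = +-3a or a = +-3b the colliding term vanishes by hypothesis, and if a
    or b is 0 the surviving coefficients do not matter.  Hence P, Q, P', Q'
    are pairwise orthogonal of constant length.  As P'' = - a ^ 2 P and
    Q'' = - b ^ 2 Q, every iterated covariant derivative of g' is then a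
    combination of P, Q or of P', Q' with constant coefficients, and the
    triharmonic equation reduces to (1 - a ^ 2) q P + (1 - b ^ 2) q Q = 0,
    where q is the left-hand side of the quartic relation. *)

(** * Vanishing of trigonometric sums on an interval *)

Section Trig.
Variables (R : realType) (V : normedModType R).
Implicit Types (w s c d : R) (u v : V).

Definition trig w u v : R -> V :=
  fun s => cos (w * s) *: u + sin (w * s) *: v.

Lemma is_derive_scalel (f : R -> R) s df v :
  is_derive s 1 f df -> is_derive s 1 (fun t => f t *: v : V) (df *: v).
Proof.
move=> dfs.
have fd : differentiable f s by apply/derivable1_diffP; case: dfs.
have gd : differentiable ( *:%R ^~ v : R -> V) (f s) by [].
have dfgs : differentiable (( *:%R ^~ v : R -> V) \o f) s.
  exact: differentiable_comp.
apply: DeriveDef; first exact: diff_derivable.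
rewrite (deriveE _ dfgs) diff_comp//=.
rewrite (@diff_val _ _ _ _ _ _ _ (is_diff_scalel _ _)).
by have [_ <-] := dfs; rewrite deriveE.
Qed.

Lemma is_derive_trig w u v s :
  is_derive s 1 (trig w u v) (trig w (w *: v) (- (w *: u)) s).
Proof.
have dl : is_derive s (1 : R) (fun t : R => w * t) w.
  by apply: is_derive_eq; rewrite /GRing.scale/= mulr1.
have dc : is_derive s (1 : R) (fun t : R => cos (w * t)) (- (w * sin (w * s))).
  apply: (is_derive_eq (@is_derive1_comp _ cos ( *%R w) s _ _ _ dl)).
  by rewrite mulNr mulrC.
have ds : is_derive s (1 : R) (fun t : R => sin (w * t)) (w * cos (w * s)).
  by apply: (is_derive_eq (@is_derive1_comp _ sin ( *%R w) s _ _ _ dl)); rewrite mulrC.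
have := is_deriveD (is_derive_scalel u dc) (is_derive_scalel v ds).
move=> H; apply: (is_derive_eq H).
by rewrite /trig scalerN !scalerA addrC scaleNr ![w * _]mulrC.
Qed.

Lemma trigZ w u v k s : trig w (k *: u) (k *: v) s = k *: trig w u v s.
Proof. by rewrite /trig scalerDr !scalerA ![k * _]mulrC. Qed.

Lemma trig_derive2 w u v s :
  trig w (w *: - (w *: u)) (- (w *: (w *: v))) s = - (w ^+ 2) *: trig w u v s.
Proof. by rewrite -trigZ scalerN !scalerA -expr2 !scaleNr. Qed.

(** Each triple holds a frequency, its cosine coefficient and its sine coefficient, so that
    differentiation becomes a map on the list. *)
Definition trig_sum (l : seq (R * V * V)) : R -> V :=
  fun s => \sum_(x <- l) trig x.1.1 x.1.2 x.2 s.

Lemma trig_sum_cons x l s :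
  trig_sum (x :: l) s = trig x.1.1 x.1.2 x.2 s + trig_sum l s.
Proof. by rewrite /trig_sum big_cons. Qed.

Lemma is_derive_trig_sum l s :
  is_derive s 1 (trig_sum l)
    (trig_sum [seq (x.1.1, x.1.1 *: x.2, - (x.1.1 *: x.1.2)) | x <- l] s).
Proof.
elim: l => [|x l IH].
  rewrite (_ : trig_sum _ = cst 0); last first.
    by apply/funext => t; rewrite /trig_sum big_nil.
  exact: is_derive_cst.
rewrite (_ : trig_sum (x :: l) = trig x.1.1 x.1.2 x.2 + trig_sum l); last first.
  by apply/funext => t; rewrite trig_sum_cons.
rewrite /= trig_sum_cons /=; apply: is_deriveD => //.
exact: is_derive_trig.
Qed.

(** The interval is open, so near each of its points the sum coincides with the zero function. *)
Lemma trig_sum_derive_eq0 l c d :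
  (forall s, c < s < d -> trig_sum l s = 0) ->
  forall s, c < s < d ->
    trig_sum [seq (x.1.1, x.1.1 *: x.2, - (x.1.1 *: x.1.2)) | x <- l] s = 0.
Proof.
move=> l0 s scd; have [_ <-] := is_derive_trig_sum l s.
rewrite (near_eq_derive (g := cst 0)) ?derive_cst// ?oner_neq0//.
have : `]c, d[%classic s by rewrite /= in_itv.
move/(near_in_itvoo); apply: filterS => t; rewrite in_itv/=.
exact: l0.
Qed.

(* With [w0] the first frequency, [F'' + w0 ^+ 2 F] no longer involves the
   first term and keeps the others up to nonzero factors. *)
Lemma trig_sum_eq0 l c d :
  uniq [seq x.1.1 ^+ 2 | x <- l] ->
  (forall s, c < s < d -> trig_sum l s = 0) ->
  forall x, x \in l -> forall s, c < s < d -> trig x.1.1 x.1.2 x.2 s = 0.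
Proof.
have [n] := ubnP (size l); elim: n l => // n IH [//|y l]; rewrite ltnS /=.
move=> szl /andP[yl ul] F0.
pose k (x : R * V * V) := y.1.1 ^+ 2 - x.1.1 ^+ 2.
pose l' := [seq (x.1.1, k x *: x.1.2, k x *: x.2) | x <- l].
have F2 := trig_sum_derive_eq0 (trig_sum_derive_eq0 F0).
have l'0 s : c < s < d -> trig_sum l' s = 0.
  move=> scd; move: (F2 _ scd) (F0 _ scd); rewrite /= !trig_sum_cons/=.
  rewrite trig_derive2 /l' /trig_sum !big_map/= => H2 H0.
  have : \sum_(x <- l) - (x.1.1 ^+ 2) *: trig x.1.1 x.1.2 x.2 s =
     y.1.1 ^+ 2 *: trig y.1.1 y.1.2 y.2 s.
    apply/eqP; rewrite -subr_eq0 addrC -scaleNr; apply/eqP; rewrite -[RHS]H2.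
    by congr (_ + _); apply: eq_bigr => x _; rewrite trig_derive2.
  move=> H3.
  under eq_bigr do rewrite trigZ /k scalerBl -scaleNr.
  by rewrite big_split/= H3 -scaler_sumr -scalerDr addrC H0 scaler0.
have l0 x : x \in l -> forall s, c < s < d -> trig x.1.1 x.1.2 x.2 s = 0.
  move=> xl s scd.
  have := IH l' _ _ l'0 (x.1.1, k x *: x.1.2, k x *: x.2).
  rewrite size_map -map_comp => /(_ szl ul (map_f _ xl) s scd) /=.
  (* If [k x] were 0, the squared frequency of [y] would recur in [l], against [uniq]. *)
  rewrite trigZ => /eqP; rewrite scaler_eq0 => /orP[|/eqP//].
  rewrite subr_eq0 => /eqP yx; case/negP: yl; rewrite yx.
  exact: (map_f (fun x : R * V * V => x.1.1 ^+ 2)).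
move=> x; rewrite inE => /predU1P[->|/l0//] s scd.
have := F0 s scd; rewrite trig_sum_cons /trig_sum big_seq big1 ?addr0// => z zl.
exact: l0.
Qed.

End Trig.

(** At the midpoint, F and F' / w are the components of (p, q) after a rotation by the angle w s;
    rotating back recovers p and q. *)
Lemma trig_coef_eq0 (R : realType) (w c d p q : R) :
  c < d -> w != 0 ->
  (forall s, c < s < d -> @trig R R^o w p q s = 0) -> p = 0 /\ q = 0.
Proof.
move=> cd w0 H.
have H1 t : c < t < d -> @trig_sum R R^o [:: (w, p, q)] t = 0.
  by rewrite /trig_sum big_seq1; exact: H.
have [c1 c2] := midf_lt cd.
set s := (c + d) / 2 in c1 c2.
have scd : c < s < d by rewrite c1 c2.
have := trig_sum_derive_eq0 H1 scd.
have := H s scd; rewrite /trig_sum/= !big_seq1/= /trig /GRing.scale/=.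
have := cos2Dsin2 (w * s).
move: (cos _) (sin _) => C S CS E1 E2.
have {}E2 : C * q - S * p = 0.
  by apply: (mulfI w0); rewrite mulr0 -[RHS]E2; ring.
split.
  have -> : p = (C ^+ 2 + S ^+ 2) * p by rewrite CS mul1r.
  by transitivity (C * (C * p + S * q) - S * (C * q - S * p));
    [ring|rewrite E1 E2; ring].
have -> : q = (C ^+ 2 + S ^+ 2) * q by rewrite CS mul1r.
by transitivity (S * (C * p + S * q) + C * (C * q - S * p));
  [ring|rewrite E1 E2; ring].
Qed.

(** The leading [0] in the [uniq] list excludes the zero frequency, whose sine coefficient is
    invisible. *)
Lemma trig_sum_coef_eq0 (R : realType) (l : seq (R * R * R)) (c d : R) :
  c < d -> uniq (0 :: [seq x.1.1 ^+ 2 | x <- l]) ->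
  (forall s, c < s < d -> @trig_sum R R^o l s = 0) ->
  forall i, (i < size l)%N -> (nth (0, 0, 0) l i).1.2 = 0 /\ (nth (0, 0, 0) l i).2 = 0.
Proof.
move=> cd /= /andP[l0 ul] F0 i il.
set x := nth _ l i; have xl : x \in l by exact: mem_nth.
apply: (@trig_coef_eq0 _ x.1.1 c d) => //; last first.
  exact: (@trig_sum_eq0 R R^o l).
apply: contraNneq l0 => x0.
by apply/mapP; exists x => //; rewrite x0 expr0n.
Qed.

(** * Resonances among the frequencies 2a, 2b, a - b, a + b *)

Lemma sqr_neq (R : idomainType) (x y : R) :
  x - y != 0 -> x + y != 0 -> x ^+ 2 != y ^+ 2.
Proof. by move=> xy xNy; rewrite -subr_eq0 subr_sqr mulf_neq0. Qed.

Lemma halves_eq0 (R : realFieldType) (x y : R) :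
  (x + y) / 2 = 0 -> (x - y) / 2 = 0 -> x = 0 /\ y = 0.
Proof. by move=> *; split; lra. Qed.

(** Serves to show that the two resonances cannot occur together when the frequencies are
    nonzero. *)
Lemma mutual_ninefold_eq0 (R : realFieldType) (x y : R) :
  x = 9 * y -> y = 9 * x -> x = 0.
Proof. by move=> *; lra. Qed.

Lemma sin_double (R : realType) (w s : R) :
  sin (2 * w * s) = 2 * (sin (w * s) * cos (w * s)).
Proof.
by rewrite (_ : 2 * w * s = w * s + w * s) ?sinD; ring.
Qed.

(** Each [k] stands for an inner product of two of the vectors. A weight a or b accompanies every
    coefficient of a sine that a zero frequency would kill; [k13] multiplies cosines only. *)
Lemma trig_products_coef_eq0 (R : realType) (a b c d k12 k34 k13 k14 k23 k24 : R) :
  c < d -> a ^+ 2 != b ^+ 2 ->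
  (b ^+ 2 = 9 * a ^+ 2 -> k12 = 0) -> (a ^+ 2 = 9 * b ^+ 2 -> k34 = 0) ->
  (forall s, c < s < d ->
     cos (a * s) * sin (a * s) * k12 + cos (b * s) * sin (b * s) * k34
     + cos (a * s) * cos (b * s) * k13 + cos (a * s) * sin (b * s) * k14
     + sin (a * s) * cos (b * s) * k23 + sin (a * s) * sin (b * s) * k24 = 0) ->
  [/\ a * k12 = 0, b * k34 = 0 & k13 = 0] /\
  [/\ b * k14 = 0, a * k23 = 0 & a * (b * k24) = 0].
Proof.
move=> cd ab hba hab F0.
have aBb : a - b != 0 by apply: contraNneq ab => /subr0_eq ->.
have aDb : a + b != 0.
  by apply: contraNneq ab => /eqP; rewrite addr_eq0 => /eqP ->; rewrite sqrrN.
have two0 : (2 : R) != 0 by rewrite pnatr_eq0.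
have double_neq (w : R) : w != 0 -> (2 * w) ^+ 2 != w ^+ 2.
  move=> w0; apply: sqr_neq; first by rewrite (_ : _ - _ = w) //; ring.
  by rewrite (_ : _ + _ = 3 * w) ?mulf_neq0 ?pnatr_eq0//; ring.
have halfK (x : R) : x / 2 = 0 -> x = 0.
  by move/eqP; rewrite mulf_eq0 invr_eq0 (negPf two0) orbF => /eqP.
(* For a = 0 only the frequencies 2b and b survive; the undetermined [k12], [k23], [k24] carry the
   weight a in the conclusion. *)
have [a0|a0] := eqVneq a 0.
  have b0 : b != 0 by move: aBb; rewrite a0 sub0r oppr_eq0.
  pose l : seq (R * R * R) := [:: (2 * b, 0, k34 / 2); (b, k13, k14)].
  have ul : uniq (0 :: [seq x.1.1 ^+ 2 | x <- l]).
    by rewrite /= !inE !negb_or ![0 == _]eq_sym !expf_neq0 ?mulf_neq0 ?double_neq.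
  have l0 s : c < s < d -> @trig_sum R R^o l s = 0.
    move=> /F0 <-; rewrite /trig_sum !big_cons big_nil /trig /GRing.scale/=.
    by rewrite a0 mul0r cos0 sin0 sin_double; field.
  have H := trig_sum_coef_eq0 cd ul l0.
  have /= [_ /halfK k34_0] := H 0%N isT; have /= [k13_0 k14_0] := H 1%N isT.
  by rewrite a0 k34_0 k13_0 k14_0 !mul0r !mulr0.
have [b0|b0] := eqVneq b 0.
  pose l : seq (R * R * R) := [:: (2 * a, 0, k12 / 2); (a, k13, k23)].
  have ul : uniq (0 :: [seq x.1.1 ^+ 2 | x <- l]).
    by rewrite /= !inE !negb_or ![0 == _]eq_sym !expf_neq0 ?mulf_neq0 ?double_neq.
  have l0 s : c < s < d -> @trig_sum R R^o l s = 0.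
    move=> /F0 <-; rewrite /trig_sum !big_cons big_nil /trig /GRing.scale/=.
    by rewrite b0 mul0r cos0 sin0 sin_double; field.
  have H := trig_sum_coef_eq0 cd ul l0.
  have /= [_ /halfK k12_0] := H 0%N isT; have /= [k13_0 k23_0] := H 1%N isT.
  by rewrite b0 k12_0 k13_0 k23_0 !mul0r !mulr0.
(* [la] and [lb] come from the double-angle formula, [l] from the product-to-sum formulas. *)
pose la : R * R * R := (2 * a, 0, k12 / 2).
pose lb : R * R * R := (2 * b, 0, k34 / 2).
pose l : seq (R * R * R) := [:: (a - b, (k13 + k24) / 2, (k23 - k14) / 2);
  (a + b, (k13 - k24) / 2, (k14 + k23) / 2)].
have trig_sumE s : @trig_sum R R^o [:: la, lb & l] s =
     cos (a * s) * sin (a * s) * k12 + cos (b * s) * sin (b * s) * k34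
     + cos (a * s) * cos (b * s) * k13 + cos (a * s) * sin (b * s) * k14
     + sin (a * s) * cos (b * s) * k23 + sin (a * s) * sin (b * s) * k24.
  rewrite /trig_sum !big_cons big_nil /trig /GRing.scale/=.
  by rewrite !sin_double (mulrBl s a b) (mulrDl a b s) cosB cosD sinB sinD; field.
have aBbDb : (a - b) ^+ 2 != (a + b) ^+ 2.
  apply: sqr_neq; first by rewrite (_ : _ - _ = - (2 * b)) ?oppr_eq0 ?mulf_neq0//; ring.
  by rewrite (_ : _ + _ = 2 * a) ?mulf_neq0//; ring.
(* [2 w] resonates with [a - b] or [a + b] only if the other frequency is [3 w]. *)
have double_neqBD (u v : R) : u - v != 0 -> u + v != 0 -> v ^+ 2 <> 9 * u ^+ 2 ->
    (2 * u) ^+ 2 != (u - v) ^+ 2 /\ (2 * u) ^+ 2 != (u + v) ^+ 2.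
  move=> uBv uDv uv.
  have u3Bv : 3 * u - v != 0.
    by apply/eqP => /subr0_eq E; apply: uv; rewrite -E; ring.
  have u3Dv : 3 * u + v != 0.
    apply/eqP => /eqP; rewrite addrC addr_eq0 => /eqP E; apply: uv; rewrite E; ring.
  split; apply: sqr_neq.
  - by rewrite (_ : _ - _ = u + v)//; ring.
  - by rewrite (_ : _ + _ = 3 * u - v)//; ring.
  - by rewrite (_ : _ - _ = u - v)//; ring.
  - by rewrite (_ : _ + _ = 3 * u + v)//; ring.
have aneq : b ^+ 2 <> 9 * a ^+ 2 ->
    (2 * a) ^+ 2 != (a - b) ^+ 2 /\ (2 * a) ^+ 2 != (a + b) ^+ 2.
  exact: double_neqBD.
have bneq : a ^+ 2 <> 9 * b ^+ 2 ->
    (2 * b) ^+ 2 != (a - b) ^+ 2 /\ (2 * b) ^+ 2 != (a + b) ^+ 2.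
  rewrite -[a - b]opprB sqrrN [a + b]addrC.
  move=> nab; apply: double_neqBD => //; last by rewrite addrC.
  by rewrite -opprB oppr_eq0.
have ul : uniq (0 :: [seq x.1.1 ^+ 2 | x <- l]).
  by rewrite /= !inE !negb_or ![0 == _]eq_sym !expf_neq0 ?aBbDb.
have concl : k12 = 0 -> k34 = 0 -> (k13 + k24) / 2 = 0 /\ (k23 - k14) / 2 = 0 ->
   (k13 - k24) / 2 = 0 /\ (k14 + k23) / 2 = 0 ->
  [/\ a * k12 = 0, b * k34 = 0 & k13 = 0] /\
  [/\ b * k14 = 0, a * k23 = 0 & a * (b * k24) = 0].
  move=> k12_0 k34_0 [E1 E2] [E3 E4].
  have [k13_0 k24_0] := halves_eq0 E1 E3.
  have [k23_0 k14_0] : k23 = 0 /\ k14 = 0 by apply: halves_eq0; rewrite // addrC.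
  by rewrite k12_0 k34_0 k13_0 k14_0 k23_0 k24_0 !mulr0.
(* Removing a resonant term, whose coefficients are zero, makes the squared frequencies distinct
   again. *)
have drop_eq0 x s : x.1.2 = 0 -> x.2 = 0 -> forall m,
    @trig_sum R R^o (x :: m) s = @trig_sum R R^o m s.
  by move=> x1 x2 m; rewrite trig_sum_cons /trig x1 x2 !scaler0 !add0r.
have dropa : k12 = 0 -> forall m s, @trig_sum R R^o (la :: m) s = @trig_sum R R^o m s.
  by move=> k m s; apply: drop_eq0; rewrite //= k mul0r.
have dropb : k34 = 0 -> forall m s, @trig_sum R R^o (lb :: m) s = @trig_sum R R^o m s.
  by move=> k m s; apply: drop_eq0; rewrite //= k mul0r.
move: ul; rewrite /= !inE !negb_or => /and3P[/andP[n1 n2] n3 _].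
(* For b = +-3a the term [la] collides with [l] and is dropped; since a is nonzero, [lb] cannot
   collide as well. *)
have [eba|nba] := pselect (b ^+ 2 = 9 * a ^+ 2).
  have k12_0 := hba eba.
  have [|b1 b2] := bneq.
    move=> eab; have /eqP := a0; apply; apply/eqP; rewrite -sqrf_eq0.
    exact/eqP/(mutual_ninefold_eq0 eab eba).
  have ul : uniq (0 :: [seq x.1.1 ^+ 2 | x <- lb :: l]).
    by rewrite /= !inE !negb_or n1 n2 n3 b1 b2 [0 == _]eq_sym expf_neq0 ?mulf_neq0.
  have l0 s : c < s < d -> @trig_sum R R^o (lb :: l) s = 0.
    by move=> /F0 <-; rewrite -trig_sumE dropa.
  have H := trig_sum_coef_eq0 cd ul l0.
  have /= [_ /halfK k34_0] := H 0%N isT.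
  by have /= := H 2%N isT; have /= := H 1%N isT; auto.
have [a1 a2] := aneq nba.
have [eab|nab] := pselect (a ^+ 2 = 9 * b ^+ 2).
  have k34_0 := hab eab.
  have ul : uniq (0 :: [seq x.1.1 ^+ 2 | x <- la :: l]).
    by rewrite /= !inE !negb_or n1 n2 n3 a1 a2 [0 == _]eq_sym expf_neq0 ?mulf_neq0.
  have l0 s : c < s < d -> @trig_sum R R^o (la :: l) s = 0.
    by move=> /F0 <-; rewrite -trig_sumE !(trig_sum_cons la) dropb.
  have H := trig_sum_coef_eq0 cd ul l0.
  have /= [_ /halfK k12_0] := H 0%N isT.
  by have /= := H 2%N isT; have /= := H 1%N isT; auto.
have [b1 b2] := bneq nab.
have ul : uniq (0 :: [seq x.1.1 ^+ 2 | x <- [:: la, lb & l]]).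
  rewrite /= !inE !negb_or n1 n2 n3 a1 a2 b1 b2 ![0 == _]eq_sym !expf_neq0 ?mulf_neq0//=.
  by rewrite !andbT !exprMn (inj_eq (mulfI _)) ?expf_neq0.
have l0 s : c < s < d -> @trig_sum R R^o [:: la, lb & l] s = 0.
  by move=> /F0 <-; rewrite -trig_sumE.
have H := trig_sum_coef_eq0 cd ul l0.
have /= [_ /halfK k12_0] := H 0%N isT.
have /= [_ /halfK k34_0] := H 1%N isT.
by have /= := H 3%N isT; have /= := H 2%N isT; auto.
Qed.

(** * The Euclidean inner product *)

Section Dot.
Variables (R : realType) (n : nat).
Implicit Types u v w : 'rV[R]_n.+1.

Lemma dotvC u v : dotv u v = dotv v u.
Proof. by apply: eq_bigr => i _; rewrite mulrC. Qed.

Lemma dotvDl u v w : dotv (u + v) w = dotv u w + dotv v w.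
Proof. by rewrite -big_split; apply: eq_bigr => i _; rewrite mxE mulrDl. Qed.

Lemma dotvZl k u v : dotv (k *: u) v = k * dotv u v.
Proof. by rewrite /dotv mulr_sumr; apply: eq_bigr => i _; rewrite mxE mulrA. Qed.

Lemma dotvDr u v w : dotv u (v + w) = dotv u v + dotv u w.
Proof. by rewrite dotvC dotvDl ![dotv _ u]dotvC. Qed.

Lemma dotvZr k u v : dotv u (k *: v) = k * dotv u v.
Proof. by rewrite dotvC dotvZl dotvC. Qed.

Lemma dotvv_ge0 u : 0 <= dotv u u.
Proof. by apply: sumr_ge0 => i _; rewrite -expr2 sqr_ge0. Qed.

Lemma sqr_enorm u : enorm u ^+ 2 = dotv u u.
Proof. by rewrite sqr_sqrtr ?dotvv_ge0. Qed.

End Dot.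

(** * Combinations of two circular motions with constant coefficients *)

Definition comb (R : realType) (V : lmodType R) (p q : R) (P Q : R -> V) : R -> V :=
  fun s => p *: P s + q *: Q s.

Section Comb.
Variables (R : realType) (V : normedModType R).
Implicit Types (a b p q s : R) (u v : V).

Lemma is_derive_comb a b p q u v u' v' s :
  is_derive s 1 (comb p q (trig a u v) (trig b u' v'))
   (comb p q (trig a (a *: v) (- (a *: u)))
      (trig b (b *: v') (- (b *: u'))) s).
Proof. by apply: is_deriveD; apply: is_deriveZ; exact: is_derive_trig. Qed.

Lemma derive1_comb a b p q u v u' v' :
  derive1 (comb p q (trig a u v) (trig b u' v')) =
  comb p q (trig a (a *: v) (- (a *: u)))
      (trig b (b *: v') (- (b *: u'))).
Proof.
by apply/funext => s; rewrite derive1E; have [_] := is_derive_comb a b p q u v u' v' s.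
Qed.

(** Differentiation keeps the shape and changes only the four vectors, over which the induction
    therefore generalizes. *)
Lemma derivable_derive1n_comb a b p q k u v u' v' s :
  derivable (derive1n k (comb p q (trig a u v) (trig b u' v'))) s 1.
Proof.
elim: k u v u' v' => [|k IH] u v u' v'.
  by have [] := is_derive_comb a b p q u v u' v' s.
by rewrite /derive1n iterSr derive1_comb; exact: IH.
Qed.

End Comb.

(** * Iterated covariant derivatives and the triharmonic equation *)

(* In the application P and Q are circular motions of squared angular
   velocities x and y and squared radii A and B, with P1 = P' and Q1 = Q'. *)
Section TwoCircles.
Variables (R : realType) (n : nat) (x y A B : R).
Local Notation V := 'rV[R]_n.+1.
Variables P Q P1 Q1 : R -> V.
Hypothesis dP : forall p q, derive1 (comb p q P Q) = comb p q P1 Q1.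
Hypothesis dP1 : forall p q, derive1 (comb p q P1 Q1) = comb (- (x * p)) (- (y * q)) P Q.
Hypothesis dotP : forall p q p' q' s,
  dotv (comb p q P Q s) (comb p' q' P Q s) = p * p' * A + q * q' * B.
Hypothesis dotP1 : forall p q p' q' s,
  dotv (comb p q P1 Q1 s) (comb p' q' P1 Q1 s) = p * p' * (x * A) + q * q' * (y * B).
Hypothesis dotPP1 : forall p q p' q' s,
  dotv (comb p q P Q s) (comb p' q' P1 Q1 s) = 0.
Hypothesis AB1 : A + B = 1.
Hypothesis speed1 : x * A + y * B = 1.
Local Notation g := (comb 1 1 P Q).

Let dotP1P p q p' q' s : dotv (comb p q P1 Q1 s) (comb p' q' P Q s) = 0.
Proof. by rewrite dotvC. Qed.

(** The derivative is a combination of velocities, already orthogonal to [g], so the projection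
    removes nothing. *)
Lemma covd_comb p q : covd g (comb p q P Q) = comb p q P1 Q1.
Proof. by apply/funext => s; rewrite /covd dP dotP1P scale0r subr0. Qed.

(** Here [- m] is the normal component of the derivative along [g] = P + Q, so projecting adds [m]
    to both coefficients. *)
Lemma covd_comb1 p q (m := x * p * A + y * q * B) :
  covd g (comb p q P1 Q1) = comb (m - x * p) (m - y * q) P Q.
Proof.
apply/funext => s; rewrite /covd dP1 dotP !mulr1 !mulNr -opprD -/m /comb (scaleNr m) opprK.
rewrite !scale1r scalerDr addrACA -!scalerDl.
by congr (_ *: _ + _ *: _); ring.
Qed.

(** [al] and [be] are the coefficients of the acceleration; [om] is the factor by which a twofold
    covariant derivative multiplies the acceleration. *)
Let al : R := 1 - x.
Let be : R := 1 - y.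
Let om : R := 1 - x - y.

(** Follows from x (1 - x) = [om] x + x y and its mirror image. The value is both the inner product
    of [nablaT 2 g] with T and the [m] needed for [nablaT 3 g]. *)
Let gram2 : x * al * A + y * be * B = al * be.
Proof.
transitivity (om * (x * A + y * B) + x * y * (A + B)); first by rewrite /om /al /be; ring.
by rewrite AB1 speed1 /om /al /be; ring.
Qed.

Lemma nablaT0E : nablaT 0 g = comb 1 1 P1 Q1.
Proof. exact: dP. Qed.

Lemma nablaT1E : nablaT 1 g = comb al be P Q.
Proof.
rewrite /nablaT iterS -/(nablaT 0 g) nablaT0E covd_comb1.
by rewrite !mulr1 speed1.
Qed.

Lemma nablaT2E : nablaT 2 g = comb al be P1 Q1.
Proof. by rewrite /nablaT iterS -/(nablaT 1 g) nablaT1E covd_comb. Qed.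

Lemma nablaT3E : nablaT 3 g = comb (al * om) (be * om) P Q.
Proof.
rewrite /nablaT iterS -/(nablaT 2 g) nablaT2E covd_comb1 gram2.
by congr (comb _ _ P Q); rewrite /al /be /om; ring.
Qed.

Lemma nablaT4E : nablaT 4 g = comb (al * om) (be * om) P1 Q1.
Proof. by rewrite /nablaT iterS -/(nablaT 3 g) nablaT3E covd_comb. Qed.

Lemma nablaT5E : nablaT 5 g =
  comb (om * (al * be) - x * (al * om)) (om * (al * be) - y * (be * om)) P Q.
Proof.
rewrite /nablaT iterS -/(nablaT 4 g) nablaT4E covd_comb1.
suff -> : x * (al * om) * A + y * (be * om) * B = om * (al * be) by [].
by rewrite -gram2; ring.
Qed.

(** T is a unit field orthogonal to [nablaT 1 g] and [nablaT 3 g], so the curvature terms contribute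
    [nablaT 3 g] and [al * be] times [nablaT 1 g]. The total is [nablaT 1 g] times om^2 + om + al
    be, which expands to the quartic. *)
Lemma triharmonic_comb s :
  x ^+ 2 + y ^+ 2 - 4 * (x + y) + 3 * x * y + 3 = 0 ->
  nablaT 5 g s + curv (nablaT 3 g s) (nablaT 0 g s) (nablaT 0 g s)
    - curv (nablaT 2 g s) (nablaT 1 g s) (nablaT 0 g s) = 0.
Proof.
move=> quartic.
rewrite nablaT5E nablaT3E nablaT2E nablaT1E nablaT0E /curv.
rewrite !dotP1 !dotPP1 !scale0r !mulr1 !mul1r speed1 scale1r subr0 sub0r opprK.
rewrite (_ : al * (x * A) + be * (y * B) = al * be); last by rewrite -gram2; ring.
rewrite /comb scalerDr !scalerA [X in X + _ = _]addrACA -!scalerDl addrACA -!scalerDl.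
set p := (X in X *: _ + _); set q := (X in _ + X *: _).
have -> : p = al * (x ^+ 2 + y ^+ 2 - 4 * (x + y) + 3 * x * y + 3).
  by rewrite /p /al /be /om; ring.
have -> : q = be * (x ^+ 2 + y ^+ 2 - 4 * (x + y) + 3 * x * y + 3).
  by rewrite /q /al /be /om; ring.
by rewrite quartic !mulr0 !scale0r addr0.
Qed.

(** The squared length is al^2 A + be^2 B; its vanishing would force A = B = 0, against A + B =
    1. *)
Lemma nablaT1_comb_neq0 s : 0 <= A -> 0 <= B -> x != 1 -> y != 1 -> nablaT 1 g s != 0.
Proof.
move=> A0 B0 x1 y1; apply/eqP; rewrite nablaT1E => E.
have al0 : 0 < al * al by rewrite -expr2 exprn_even_gt0//= /al subr_eq0 eq_sym.
have be0 : 0 < be * be by rewrite -expr2 exprn_even_gt0//= /be subr_eq0 eq_sym.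
have := dotP al be al be s; rewrite E -[X in dotv X _](scale0r 0) dotvZl mul0r.
move/esym/eqP; rewrite paddr_eq0 ?pmulr_rge0// !(mulf_eq0 (_ * _)) (gt_eqF al0) (gt_eqF be0).
case/andP => /eqP A_0 /eqP B_0; move/eqP: AB1.
by rewrite A_0 B_0 addr0 eq_sym oner_eq0.
Qed.

End TwoCircles.

(** * Inner products of circular motions and their velocities *)

Lemma dotv_trig (R : realType) (n : nat) (a b : R) (u v u' v' : 'rV[R]_n.+1) (s : R) :
  dotv (trig a u v s) (trig b u' v' s) =
    cos (a * s) * cos (b * s) * dotv u u' + cos (a * s) * sin (b * s) * dotv u v'
    + sin (a * s) * cos (b * s) * dotv v u' + sin (a * s) * sin (b * s) * dotv v v'.
Proof. by rewrite /trig !dotvDl !dotvDr !dotvZl !dotvZr; ring. Qed.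

Lemma dotv_comb (R : realType) (n : nat) (p q p' q' : R)
    (P Q P' Q' : R -> 'rV[R]_n.+1) (s : R) :
  dotv (comb p q P Q s) (comb p' q' P' Q' s) =
    p * p' * dotv (P s) (P' s) + p * q' * dotv (P s) (Q' s)
    + q * p' * dotv (Q s) (P' s) + q * q' * dotv (Q s) (Q' s).
Proof. by rewrite /comb !dotvDl !dotvDr !dotvZl !dotvZr; ring. Qed.

(** Makes weighted orthogonality sufficient: either the coefficient or the frequency is zero, and
    the latter kills the sine. *)
Lemma sin_coef_eq0 (R : realType) (a s k : R) : a * k = 0 -> sin (a * s) * k = 0.
Proof.
move/eqP; rewrite mulf_eq0 => /orP[]/eqP->; first by rewrite mul0r sin0 mul0r.
by rewrite mulr0.
Qed.

Section OneCircle.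
Variables (R : realType) (n : nat) (a A : R) (u v : 'rV[R]_n.+1).
Hypotheses (uu : dotv u u = A) (vv : dotv v v = A) (uv : a * dotv u v = 0).
Local Notation P := (trig a u v).
Local Notation P1 := (trig a (a *: v) (- (a *: u))).

Lemma dotv_circle s : dotv (P s) (P s) = A.
Proof.
have H := sin_coef_eq0 s uv.
rewrite dotv_trig uu vv (dotvC v u).
transitivity ((cos (a * s) ^+ 2 + sin (a * s) ^+ 2) * A
   + 2 * cos (a * s) * (sin (a * s) * dotv u v)); first by ring.
by rewrite cos2Dsin2 H; ring.
Qed.

Lemma dotv_circle_tangent s : dotv (P s) (P1 s) = 0.
Proof.
rewrite dotv_trig -!scaleNr !dotvZr uu vv (dotvC v u).
transitivity ((cos (a * s) ^+ 2 - sin (a * s) ^+ 2) * (a * dotv u v)); first by ring.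
by rewrite uv mulr0.
Qed.

Lemma dotv_tangent s : dotv (P1 s) (P1 s) = a ^+ 2 * A.
Proof.
rewrite dotv_trig -!scaleNr !dotvZr !dotvZl uu vv (dotvC v u).
transitivity (a ^+ 2 * ((cos (a * s) ^+ 2 + sin (a * s) ^+ 2) * A)
  - 2 * cos (a * s) * sin (a * s) * a * (a * dotv u v)); first by ring.
by rewrite cos2Dsin2 uv; ring.
Qed.

End OneCircle.

Section OrthogonalCircles.
Variables (R : realType) (n : nat) (a b : R) (u v u' v' : 'rV[R]_n.+1).
Hypotheses (uu' : dotv u u' = 0) (uv' : b * dotv u v' = 0).
Hypotheses (vu' : a * dotv v u' = 0) (vv' : a * (b * dotv v v') = 0).
Local Notation P := (trig a u v).
Local Notation Q := (trig b u' v').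
Local Notation P1 := (trig a (a *: v) (- (a *: u))).
Local Notation Q1 := (trig b (b *: v') (- (b *: u'))).

Lemma dotv_circles s : dotv (P s) (Q s) = 0.
Proof.
have Huv' := sin_coef_eq0 s uv'; have Hvu' := sin_coef_eq0 s vu'.
have Hvv' : sin (a * s) * (sin (b * s) * dotv v v') = 0.
  (* One sine absorbs the weight a, the other the weight b. *)
  by apply: sin_coef_eq0; rewrite mulrCA; apply: sin_coef_eq0; rewrite mulrCA.
rewrite dotv_trig uu' -!mulrA Huv' Hvv' (mulrCA (sin (a * s))) Hvu'.
by rewrite !mulr0 !addr0.
Qed.

(** Differentiating Q supplies the weight b, and the sine of a s absorbs the weight a. *)
Lemma dotv_circles_tangent s : dotv (P s) (Q1 s) = 0.
Proof.
have Hvu' := sin_coef_eq0 s vu'; have Hvv' := sin_coef_eq0 s vv'.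
rewrite dotv_trig -!scaleNr !dotvZr uu'.
transitivity (cos (a * s) * cos (b * s) * (b * dotv u v')
  + cos (b * s) * (sin (a * s) * (b * dotv v v'))
  - sin (b * s) * b * (sin (a * s) * dotv v u')); first by ring.
by rewrite uv' Hvv' Hvu'; ring.
Qed.

Lemma dotv_tangents s : dotv (P1 s) (Q1 s) = 0.
Proof.
rewrite dotv_trig -!scaleNr !dotvZr !dotvZl uu'.
transitivity (cos (a * s) * cos (b * s) * (a * (b * dotv v v'))
  - cos (a * s) * sin (b * s) * b * (a * dotv v u')
  - sin (a * s) * cos (b * s) * a * (b * dotv u v')); first by ring.
by rewrite uv' vu' vv'; ring.
Qed.

End OrthogonalCircles.

(* The last four hypotheses exclude exactly the degenerate data for which the
   conclusion fails: a ^+ 2 = 1 or b ^+ 2 = 1 makes g a great circle, and in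
   the resonances b = +-3a and a = +-3b non-orthogonal vectors e_i can still
   give a curve on the sphere, which then does not have unit speed. *)
Theorem theorem1p3 (R : realType) (n : nat) (I : set R) (a b : R)
    (e1 e2 e3 e4 : 'rV[R]_n.+1) (g : R -> 'rV[R]_n.+1)
    (hI : nondegenerate_interval I)
    (hg : forall s : R,
        g s = cos (a * s) *: e1 + sin (a * s) *: e2
              + cos (b * s) *: e3 + sin (b * s) *: e4)
    (hgS : maps_to_sphere I g)
    (h12 : enorm e1 ^+ 2 = enorm e2 ^+ 2)
    (h34 : enorm e3 ^+ 2 = enorm e4 ^+ 2)
    (h13 : enorm e1 ^+ 2 + enorm e3 ^+ 2 = 1)
    (hquartic : a ^+ 4 + b ^+ 4 - 4 * (a ^+ 2 + b ^+ 2)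
                + 3 * a ^+ 2 * b ^+ 2 + 3 = 0)
    (hspeed : enorm e1 ^+ 2 * a ^+ 2 + enorm e3 ^+ 2 * b ^+ 2 = 1)
    (ha : a ^+ 2 <> 1) (hb : b ^+ 2 <> 1)
    (hba : b ^+ 2 = 9 * a ^+ 2 -> dotv e1 e2 = 0)
    (hab : a ^+ 2 = 9 * b ^+ 2 -> dotv e3 e4 = 0) :
  proper_triharmonic I g /\ arclength_param I g.
Proof.
rewrite !sqr_enorm in h12 h34 h13 hspeed.
set A := dotv e1 e1 in h12 h13 hspeed; set B := dotv e3 e3 in h34 h13 hspeed.
move: ha hb => /eqP ha /eqP hb.
(* Equal squares would turn the speed relation into a^2 (A + B) = 1, hence a^2 = 1. *)
have nab : a ^+ 2 != b ^+ 2.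
  apply: contra_neq ha => ab.
  by rewrite -hspeed -ab -mulrDl h13 mul1r.
have gE : g = comb 1 1 (trig a e1 e2) (trig b e3 e4).
  by apply/funext => s; rewrite hg /comb /trig !scale1r addrA.
have [Iitv [c [d [Ic Id cd]]]] := hI.
have Icd s : c < s < d -> I s.
  by move=> /andP[/ltW cs /ltW sd]; apply: (Iitv c d) => //; rewrite cs.
have gg s : I s -> dotv (g s) (g s) = 1.
  by move=> /hgS gs; rewrite -sqr_enorm gs expr1n.
have [|[e12 e34 e13] [e14 e23 e24]] := trig_products_coef_eq0 (k13 := dotv e1 e3)
  (k14 := dotv e1 e4) (k23 := dotv e2 e3) (k24 := dotv e2 e4) cd nab hba hab.
  move=> s /Icd/gg; rewrite gE dotv_comb !dotv_trig -/A -/B -h12 -h34 !mul1r.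
  rewrite (dotvC e2 e1) (dotvC e4 e3) (dotvC e3 e1) (dotvC e4 e1) (dotvC e3 e2) (dotvC e4 e2).
  (* Writing 1 in this form cancels the pure squares in |g|^2 = 1; the mixed terms remain, each with
     a factor 2. *)
  have : (cos (a * s) ^+ 2 + sin (a * s) ^+ 2) * A +
      (cos (b * s) ^+ 2 + sin (b * s) ^+ 2) * B = 1.
    by rewrite !cos2Dsin2 !mul1r.
  move=> <- /eqP; rewrite -subr_eq0 => /eqP H.
  apply: (mulfI (_ : 2 != 0)); first by rewrite pnatr_eq0.
  by rewrite mulr0 -[RHS]H; ring.
pose P := trig a e1 e2; pose Q := trig b e3 e4.
pose P1 := trig a (a *: e2) (- (a *: e1)).
pose Q1 := trig b (b *: e4) (- (b *: e3)).
have dP p q : derive1 (comb p q P Q) = comb p q P1 Q1.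
  exact: derive1_comb.
have dP1 p q : derive1 (comb p q P1 Q1) =
    comb (- (a ^+ 2 * p)) (- (b ^+ 2 * q)) P Q.
  rewrite derive1_comb; apply/funext => s; rewrite /comb !trig_derive2 !scalerA.
  by rewrite !mulrN ![_ * _ ^+ 2]mulrC.
have dotP p q p' q' s :
  dotv (comb p q P Q s) (comb p' q' P Q s) = p * p' * A + q * q' * B.
  rewrite dotv_comb (@dotv_circle _ _ a A)// (@dotv_circle _ _ b B)//.
  rewrite (dotvC (Q s)) !dotv_circles//.
  by rewrite !mulr0 !addr0.
have dotP1 p q p' q' s :
  dotv (comb p q P1 Q1 s) (comb p' q' P1 Q1 s) =
    p * p' * (a ^+ 2 * A) + q * q' * (b ^+ 2 * B).
  rewrite dotv_comb (@dotv_tangent _ _ a A)// (@dotv_tangent _ _ b B)//.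
  by rewrite (dotvC (Q1 s)) !dotv_tangents// !mulr0 !addr0.
have dotPP1 p q p' q' s :
  dotv (comb p q P Q s) (comb p' q' P1 Q1 s) = 0.
  rewrite dotv_comb (@dotv_circle_tangent _ _ a A)// (@dotv_circle_tangent _ _ b B)//.
  (* The product of Q with P1 uses the same lemma with the circles exchanged, hence the swapped
     inner products. *)
  rewrite !dotv_circles_tangent// ?[dotv e3 _]dotvC ?[dotv e4 _]dotvC//.
    by rewrite !mulr0 !addr0.
  by rewrite mulrCA.
have speed1 : a ^+ 2 * A + b ^+ 2 * B = 1 by rewrite -hspeed; ring.
have quartic : (a ^+ 2) ^+ 2 + (b ^+ 2) ^+ 2 - 4 * (a ^+ 2 + b ^+ 2)
   + 3 * a ^+ 2 * b ^+ 2 + 3 = 0 by rewrite -!exprM.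
split.
  split.
    split=> // [k s _|s _]; rewrite gE.
      exact: derivable_derive1n_comb.
    exact: (triharmonic_comb dP dP1 dotP dotP1 dotPP1 h13 speed1).
  (* The acceleration vanishes nowhere, so the single point [c] of [I] refutes being a geodesic. *)
  move=> /(_ c Ic); rewrite gE; apply/eqP.
  by apply: (nablaT1_comb_neq0 dP dP1 dotP h13 speed1); rewrite ?dotvv_ge0.
by move=> s _; rewrite /enorm gE dP dotP1 !mulr1 !mul1r speed1 sqrtr1.
Qed.
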